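(* Let $d>0$. For $0<h<d$ define $$w(h)=\min\left\{d,\ \operatorname{arccosh}\left(\frac{1+2e^h\cosh(d)-e^{2h}}{2}\right)\right\},\qquad k(h)=\left\lceil e^h\sqrt{\frac{\cosh(d)-1}{\cosh(w(h))-1}}\right\rceil.$$ Then $$\chi(\mathbb{H},d)\leq \min_{0<h<d}\left\{(k(h)+1)\left(\left\lceil\frac{d}{h}\right\rceil+1\right)\right\}.$$
   Context: $\mathbb{H}=\{(x,y)\in\mathbb{R}^2 : y>0\}$ is the hyperbolic plane (upper half-plane model) with distance $d_{\mathbb{H}}((x,y),(x',y'))=\operatorname{arccosh}\left(1+\frac{(x-x')^2+(y-y')^2}{2yy'}\right)$. For $d>0$, $\chi(\mathbb{H},d)$ denotes the minimal number of colors needed to color all points of $\mathbb{H}$ so that any two points at hyperbolic distance exactly $d$ receive different colors. *)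

(* Defs.v *)
From HB Require Import structures.
From mathcomp Require Import all_boot all_order all_algebra.
From mathcomp Require Import ring lra.
From mathcomp Require Import all_classical all_reals all_analysis.

Set Implicit Arguments.
Unset Strict Implicit.
Unset Printing Implicit Defensive.

Import Order.TTheory GRing.Theory Num.Theory.
Local Open Scope classical_set_scope.
Local Open Scope ring_scope.

Definition cosh (R : realType) (x : R) : R := (expR x + expR (- x)) / 2.

(* The closed form of the nonnegative inverse of cosh on [1, +oo[; its values
   below 1 are junk. *)
Definition arccosh (R : realType) (x : R) : R := ln (x + Num.sqrt (x ^+ 2 - 1)).

Lemma arccosh_ge0 (R : realType) (x : R) : 1 <= x -> 0 <= arccosh x.
Proof. by move=> x1; apply: ln_ge0; apply: ler_wpDr => //; exact: sqrtr_ge0. Qed.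

Lemma arccoshK (R : realType) (x : R) : 1 <= x -> cosh (arccosh x) = x.
Proof.
move=> x1; set s := Num.sqrt (x ^+ 2 - 1).
have s2 : s ^+ 2 = x ^+ 2 - 1 by rewrite sqr_sqrtr //; nra.
have s0 : 0 <= s by exact: sqrtr_ge0.
have p0 : 0 < x + s by lra.
rewrite /cosh /arccosh -/s expRN lnK ?posrE //.
have -> : (x + s)^-1 = x - s.
  by apply: (mulfI (lt0r_neq0 p0)); rewrite divff ?lt0r_neq0 //; lra.
by field.
Qed.

Definition is_min (disp : Order.disp_t) (T : porderType disp) (A : set T) (m : T)
  : Prop := A m /\ lbound A m.

Definition hplane (R : realType) : Type := {p : R * R | 0 < p.2}.

Definition hdist (R : realType) (p q : hplane R) : R :=
  let: (x, y) := val p in let: (x', y') := val q in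
  arccosh (1 + ((x - x') ^+ 2 + (y - y') ^+ 2) / (2 * y * y')).

Definition colorable (R : realType) (d : R) (n : nat) : Prop :=
  exists c : hplane R -> 'I_n, forall p q, hdist p q = d -> c p <> c q.

(* n is the chromatic number chi(H, d).  Stated as a relation because the
   minimum exists only when finitely many colors suffice. *)
Definition is_chromatic_number (R : realType) (d : R) (n : nat) : Prop :=
  is_min [set m : nat | colorable d m] n.

(* For 0 < h < d both the argument of arccosh here and cosh (w d h) exceed 1,
   so neither arccosh, the square root nor the division in k is degenerate. *)
Definition w (R : realType) (d h : R) : R :=
  Num.min d (arccosh ((1 + 2 * expR h * cosh d - expR (2 * h)) / 2)).

Definition k (R : realType) (d h : R) : int :=
  Num.ceil (expR h * Num.sqrt ((cosh d - 1) / (cosh (w d h) - 1))).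

Definition color_bound (R : realType) (d h : R) : int :=
  (k d h + 1) * (Num.ceil (d / h) + 1).

(* Main.v *)
Require Import Defs.
From mathcomp Require Import all_boot all_order all_algebra.
From mathcomp Require Import ring lra zify.
From mathcomp Require Import all_classical all_reals all_analysis.
Import Order.TTheory GRing.Theory Num.Theory.
Local Open Scope classical_set_scope.
Local Open Scope ring_scope.

(** Cut the half-plane into the horocyclic strips [e^(jh) <= y < e^((j+1)h)].
    Since [d(p, q) >= |ln y - ln y'|], strips may be grouped cyclically into
    [ceil (d / h) + 1] classes without conflict between distinct strips of a
    class.  After rescaling a strip to [1 <= y < e^h], two of its points at
    distance [d] satisfy [(x - x')^2 = 2 y y' cosh d - y^2 - y'^2], which lies
    between [2 (cosh w - 1)] (attained at a corner, by concavity) and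
    [2 e^(2h) (cosh d - 1)].  Boxes of width [sqrt (2 (cosh w - 1))], colored
    cyclically with [k + 1] colors, therefore separate them. *)

Section Cosh.
Variable R : realType.
Implicit Types a b : R.

Lemma lt_cosh a b : 0 <= a -> a < b -> cosh a < cosh b.
Proof.
move=> a0 ab; rewrite /cosh !expRN.
have u1 : 1 <= expR a by rewrite -expR0 ler_expR.
have uv : expR a < expR b by rewrite ltr_expR.
move: u1 uv; set u := expR a; set v := expR b => u1 uv.
have u0 : u != 0 by apply: lt0r_neq0; lra.
have v0 : v != 0 by apply: lt0r_neq0; lra.
rewrite -subr_gt0.
have -> : (v + v^-1) / 2 - (u + u^-1) / 2 = (v - u) * (u * v - 1) / (2 * u * v).
  by field; rewrite u0 v0.
by apply: divr_gt0; [apply: mulr_gt0|apply: mulr_gt0]; nra.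
Qed.

Lemma le_cosh a b : 0 <= a -> a <= b -> cosh a <= cosh b.
Proof.
by move=> a0; rewrite le_eqVlt => /predU1P[->//|/(lt_cosh _ _ a0)/ltW].
Qed.

Lemma cosh_gt1 a : 0 < a -> 1 < cosh a.
Proof. by move=> /(lt_cosh _ _ (lexx 0)); rewrite /cosh oppr0 expR0 divff. Qed.

End Cosh.

Lemma hdist_eq (R : realType) (d : R) (p q : hplane R) : hdist p q = d ->
  ((val p).1 - (val q).1) ^+ 2 =
  2 * (val p).2 * (val q).2 * cosh d - (val p).2 ^+ 2 - (val q).2 ^+ 2.
Proof.
case: p q => [[x y] /= y0] [[x' y'] /= y'0]; rewrite /hdist /= => <-.
have yy : 0 < 2 * y * y' by rewrite !mulr_gt0.
rewrite arccoshK; last first.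
  by rewrite lerDl divr_ge0 ?addr_ge0 ?sqr_ge0 ?ltW.
by field; rewrite !lt0r_neq0.
Qed.

(** The vertical distance satisfies [cosh |ln y - ln y'| = (y^2 + y'^2) / (2 y y')], and dropping
    the square [(x - x')^2] from [hdist_eq] bounds this by [cosh d]. *)
Lemma hdist_ge_ln (R : realType) (d : R) (p q : hplane R) : 0 < d ->
  hdist p q = d -> `|ln (val p).2 - ln (val q).2| <= d.
Proof.
move=> d0 /hdist_eq; case: p q => [[x y] /= y0] [[x' y'] /= y'0] E.
rewrite leNgt; apply/negP => /(lt_cosh _ _ _ (ltW d0)).
have -> : cosh `|ln y - ln y'| = (y / y' + y' / y) / 2.
  rewrite -ln_div ?posrE // /cosh; have ratio0 : 0 < y / y' by rewrite divr_gt0.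
  by case: ger0P => _; rewrite ?opprK expRN lnK ?posrE // invf_div // addrC.
have -> : (y / y' + y' / y) / 2 = (y ^+ 2 + y' ^+ 2) / (2 * y * y').
  by field; rewrite !lt0r_neq0.
rewrite ltr_pdivlMr ?mulr_gt0 //; have := sqr_ge0 (x - x'); nra.
Qed.

(** Distinct congruent floors differ by at least [n + 1], and fractional parts recover less than 1
    of that. The strict inequality lets cyclic colors tolerate a gap of exactly [n]. Serves both
    strips and boxes. *)
Lemma eq_floor_mod (R : realType) (n : nat) (a b : R) :
  (Num.floor a = Num.floor b %[mod n.+1])%Z ->
  Num.floor a = Num.floor b \/ n%:R < `|a - b|.
Proof.
move=> E; have [->|ne] := eqVneq (Num.floor a) (Num.floor b); [by left|right].
have Fa := floor_itv a; have Fb := floor_itv b.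
have : (n.+1%:Z <= Num.floor a - Num.floor b) || (n.+1%:Z <= Num.floor b - Num.floor a).
  move: (Num.floor a) (Num.floor b) E ne {Fa Fb} => u v.
  move/eqP; rewrite eqz_mod_dvd => /dvdzP[q E] ne; have qn0 : q != 0.
    by apply: contra_neq ne => q0; move: E; rewrite q0; lia.
  have := ltrP 0 q; nia.
move: Fa Fb => /andP[a1 a2] /andP[b1 b2]; rewrite !intrD in a2 b2.
rewrite -!(ler_int R) !intrD !mulrNz -[_%:~R]/(n.+1%:R : R) -natr1 => /orP[] H.
  by apply: lt_le_trans (ler_norm _); lra.
by rewrite distrC; apply: lt_le_trans (ler_norm _); lra.
Qed.

Lemma lt1_eq_floor (R : realType) (a b : R) :
  Num.floor a = Num.floor b -> `|a - b| < 1.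
Proof.
move=> E; have := floor_itv a; have := floor_itv b; rewrite E !intrD.
by rewrite ltr_norml => /andP[? ?] /andP[? ?]; lra.
Qed.

(* Concavity in the ratio [t = b / a] of [2 t C - 1 - t^2], then homogeneity. *)
Lemma strip_width_ge (R : realFieldType) (H C mu a b : R) :
  0 < mu -> mu <= 2 * (C - 1) -> mu <= 2 * H * C - 1 - H ^+ 2 ->
  1 <= a < H -> 1 <= b < H -> mu <= 2 * a * b * C - a ^+ 2 - b ^+ 2.
Proof.
wlog ab : a b / a <= b.
  move=> W mu0 m1 m2 Ha Hb; have [ab|/ltW ba] := leP a b; first exact: W.
  by have := W _ _ ba mu0 m1 m2 Hb Ha; lra.
move=> mu0 m1 m2 /andP[a1 aH] /andP[b1 bH].
have a0 : 0 < a by lra.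
set t := b / a; have bE : b = t * a by rewrite /t divfK // lt0r_neq0.
have t1 : 1 <= t by rewrite /t ler_pdivlMr // mul1r.
have tH : t <= H by rewrite /t ler_pdivrMr //; nra.
have g : mu <= 2 * t * C - 1 - t ^+ 2.
  have H1 : 0 < H - 1 by lra.
  (* Interpolate between [t = 1] and [t = H] with weights [H - t] and [t - 1]; the last term of the
     identity is the excess of the concave function over its chord. *)
  rewrite -(ler_pM2l H1) -subr_ge0.
  have -> : (H - 1) * (2 * t * C - 1 - t ^+ 2) - (H - 1) * mu =
    (H - t) * (2 * (C - 1) - mu) + (t - 1) * (2 * H * C - 1 - H ^+ 2 - mu)
    + (H - 1) * ((t - 1) * (H - t)) by ring.
  by rewrite !addr_ge0 ?mulr_ge0 //; lra.
have -> : 2 * a * b * C - a ^+ 2 - b ^+ 2 = a ^+ 2 * (2 * t * C - 1 - t ^+ 2).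
  by rewrite bE; ring.
have a2 : 1 <= a ^+ 2 by rewrite exprn_ege1.
by rewrite (le_trans g) // ler_peMl // (le_trans (ltW mu0) g).
Qed.

(** The left side is [2 a b (C - 1) - (a - b)^2], and [a b <= H^2]. *)
Lemma strip_width_le (R : realFieldType) (H C a b : R) : 1 <= C ->
  1 <= a < H -> 1 <= b < H ->
  2 * a * b * C - a ^+ 2 - b ^+ 2 <= H ^+ 2 * (2 * (C - 1)).
Proof.
move=> C1 /andP[a1 aH] /andP[b1 bH].
have ab : a * b <= H * H by nra.
have : 0 <= (H * H - a * b) * (C - 1) by rewrite mulr_ge0 //; lra.
by have := sqr_ge0 (a - b); nra.
Qed.

Section Coloring.
Variables (R : realType) (d h : R).
Hypothesis h_itv : 0 < h < d.

Lemma cosh_w_bounds : [/\ 1 < cosh (w d h), cosh (w d h) <= cosh d &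
  2 * (cosh (w d h) - 1) <= 2 * expR h * cosh d - 1 - expR h ^+ 2].
Proof.
have /andP[h0 hd] := h_itv; have d0 : 0 < d by lra.
have C1 := cosh_gt1 _ _ d0.
have Cd := lt_cosh _ _ _ (ltW h0) hd.
set z := (1 + 2 * expR h * cosh d - expR (2 * h)) / 2.
have H2 : expR (2 * h) = expR h ^+ 2 by rewrite expRM_natl.
(* From [h < d], [2 e^h cosh d > 2 e^h cosh h = e^(2h) + 1], so [arccosh z] is not a junk value. *)
have z1 : 1 < z.
  have := expR_gt0 h; have : expR h * expR (- h) = 1 by rewrite -expRD subrr expR0.
  by rewrite /z H2; move: Cd; rewrite {1}/cosh; nra.
have zw : cosh (w d h) <= z.
  rewrite -[leRHS](arccoshK (ltW z1)).
  apply: le_cosh; last by rewrite /w ge_min lexx orbT.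
  by rewrite /w le_min arccosh_ge0 ?ltW.
split.
- by rewrite /w -/z; case: (leP d (arccosh z)) => _ //; rewrite arccoshK ?ltW.
- apply: le_cosh; last by rewrite /w ge_min lexx.
  by rewrite /w le_min arccosh_ge0 ?ltW.
- by move: zw; rewrite /z H2; lra.
Qed.

(** Strip index, height of the lower edge of the strip, and box width after rescaling that edge to
    height 1. *)
Let j (p : hplane R) : int := Num.floor (ln (val p).2 / h).
Let s (p : hplane R) : R := expR ((j p)%:~R * h).
Let m : R := Num.sqrt (2 * (cosh (w d h) - 1)).

Lemma strip_itv (p : hplane R) : 1 <= (val p).2 / s p < expR h.
Proof.
have /andP[h0 hd] := h_itv; have y0 := valP p.
have := floor_itv (ln (val p).2 / h); rewrite -/(j p) intrD.
rewrite ler_pdivlMr // ltr_pdivrMr // mulrDl mul1r => /andP[l r].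
rewrite ler_pdivlMr ?expR_gt0 // mul1r ltr_pdivrMr ?expR_gt0 // -expRD.
rewrite -[(val p).2](lnK y0).
by rewrite ler_expR l ltr_expR addrC.
Qed.

(** In units of one box, the lower bound rules out a shared box and the upper bound rules out
    distinct boxes congruent modulo [k + 1]. *)
Lemma strip_separation (p q : hplane R) (n : nat) : k d h = n%:Z ->
  hdist p q = d -> s p = s q ->
  1 <= `|(val p).1 / (m * s p) - (val q).1 / (m * s q)| <= n%:R.
Proof.
move=> kn /hdist_eq E spq; have [c1 cd cH] := cosh_w_bounds.
have m2 : m ^+ 2 = 2 * (cosh (w d h) - 1) by rewrite sqr_sqrtr //; lra.
have m0 : 0 < m by rewrite sqrtr_gt0; lra.
have sq0 : 0 < s q := expR_gt0 _.
have := strip_itv p; have := strip_itv q; rewrite !spq.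
set a := _ / s q => Ha; set b := _ / s q => Hb.
set X := _ - _.
have XE : (X * m) ^+ 2 = 2 * b * a * cosh d - b ^+ 2 - a ^+ 2.
  have -> : X * m = ((val p).1 - (val q).1) / s q.
    by rewrite /X; field; rewrite !lt0r_neq0.
  by rewrite exprMn E /a /b; field; rewrite lt0r_neq0.
have lo : m ^+ 2 <= (X * m) ^+ 2.
  by rewrite XE m2; apply: strip_width_ge Hb Ha => //; lra.
(* The ratio under the root in [k] converts the maximal gap [e^h sqrt (2 (cosh d - 1))] into
   multiples of [m]. *)
have hi : (X * m) ^+ 2 <= (n%:R * m) ^+ 2.
  rewrite XE; have C1 : 1 <= cosh d by lra.
  apply: le_trans (strip_width_le _ _ _ _ _ C1 Hb Ha) _.
  have : expR h * Num.sqrt ((cosh d - 1) / (cosh (w d h) - 1)) <= n%:R.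
    by have := ceil_ge (expR h * Num.sqrt ((cosh d - 1) / (cosh (w d h) - 1)));
       rewrite -/(k d h) kn.
  have c0 : 0 < cosh (w d h) - 1 by lra.
  rewrite -ler_sqr ?nnegrE ?mulr_ge0 ?expR_ge0 ?sqrtr_ge0 //.
  have q0 : 0 <= (cosh d - 1) / (cosh (w d h) - 1).
    by apply: divr_ge0; [lra|exact: ltW].
  rewrite exprMn sqr_sqrtr // [X in X <= _ -> _]mulrA ler_pdivrMr // exprMn m2; nra.
move: lo hi; rewrite !exprMn -{1}[m ^+ 2]mul1r !ler_pM2r ?exprn_gt0 //.
rewrite -[X ^+ 2]real_normK ?num_real // -{1}(expr1n _ 2).
by rewrite !ler_sqr ?nnegrE // => -> ->.
Qed.

Lemma color_bound_colorable :
  exists2 n : nat, colorable d n & n%:Z = color_bound d h.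
Proof.
have /andP[h0 hd] := h_itv; have d0 : 0 < d by lra.
have [n kn] : exists n : nat, k d h = n%:Z.
  by exists `|k d h|%N; rewrite gez0_abs // /k ceil_ge0 (lt_le_trans (ltrN10 _)) //.
have [l lE] : exists l : nat, Num.ceil (d / h) = l%:Z.
  exists `|Num.ceil (d / h)|%N; rewrite gez0_abs // ceil_ge0 (lt_le_trans (ltrN10 _)) //.
  by rewrite divr_ge0 ?ltW.
pose res (i : nat) (z : int) : 'I_i.+1 := inord `|(z %% i.+1)%Z|%N.
have resP i u v : res i u = res i v -> (u = v %[mod i.+1])%Z.
  have H z : (`|(z %% i.+1)%Z|%N < i.+1)%N.
    by have := @ltz_pmod z i.+1 isT; have := @modz_ge0 z i.+1 isT; lia.
  move=> /(congr1 val) /=; rewrite !inordK // => /(congr1 Posz).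
  by rewrite !gez0_abs ?modz_ge0.
pose c (p : hplane R) := (res n (Num.floor ((val p).1 / (m * s p))), res l (j p)).
exists #|{: 'I_n.+1 * 'I_l.+1}|; last first.
  by rewrite card_prod !card_ord /color_bound kn lE; lia.
exists (fun p => enum_rank (c p)) => p q pq /enum_rank_inj[/resP cx /resP cy].
(* Distinct strips of one class would give [|ln y - ln y'| > l h >= d]. *)
have jpq : j p = j q.
  have [//|] := eq_floor_mod _ _ _ _ cy.
  rewrite -mulrBl normrM normfV (gtr0_norm h0) ltr_pdivlMr // => L.
  have := hdist_ge_ln _ _ _ _ d0 pq.
  have : d <= l%:R * h.
    by rewrite -ler_pdivrMr //; have := ceil_ge (d / h); rewrite lE.
  by move=> *; exfalso; lra.
have spq : s p = s q by rewrite /s jpq.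
have /andP[lo hi] := strip_separation _ _ _ kn pq spq.
have [/lt1_eq_floor|] := eq_floor_mod _ _ _ _ cx; lra.
Qed.

End Coloring.

Lemma ex_is_min_nat (A : set nat) : A !=set0 -> exists n, is_min A n.
Proof.
move=> [a Aa].
have ex : exists n, `[< A n >] by exists a; apply/asboolP.
exists (ex_minn ex); case: ex_minnP => n /asboolP An nmin.
by split=> // i Ai; rewrite leEnat nmin //; apply/asboolP.
Qed.

(* chi(H, d) <= min_(0 < h < d) color_bound d h, including that both the
   chromatic number and the minimum exist. *)
Theorem mainTheorem6 (R : realType) (d : R) (d_gt0 : 0 < d) :
  exists (chi : nat) (m : int),
    [/\ is_chromatic_number d chi,
        is_min [set color_bound d h | h in [set h : R | 0 < h < d]] m
      & chi%:Z <= m].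
Proof.
have h_half : 0 < d / 2 < d by apply/andP; split; lra.
have [n0 cn0 En0] := color_bound_colorable _ _ _ h_half.
have [chi [chi_col chi_min]] : exists n, is_chromatic_number d n.
  by apply: ex_is_min_nat; exists n0.
(* All bounds are natural numbers, so the minimum over the continuum of [h] is attained by
   well-ordering. *)
have [m [[h hd Em] m_min]] : exists m, is_min
    [set n : nat | exists2 h, 0 < h < d & n%:Z = color_bound d h] m.
  by apply: ex_is_min_nat; exists n0, (d / 2).
exists chi, m%:Z; split=> //.
- split; first by exists h.
  move=> _ [h' hd' <-]; have [n _ En] := color_bound_colorable _ _ _ hd'.
  by rewrite -En lez_nat -leEnat; apply: m_min; exists h'.
- have [n cn En] := color_bound_colorable _ _ _ hd.
  by move: En; rewrite -Em => -[<-]; rewrite lez_nat -leEnat; apply: chi_min.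
Qed.
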